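(* Let $p$ be a prime number and let $(X,S)$ be an indecomposable nondegenerate braided set with $|X|=p$. Then $(X,S)$ is affine, i.e. it is isomorphic to an affine solution on the abelian group $\mathbb{Z}_p=\mathbb{Z}/p\mathbb{Z}$. In particular, $(X,S)$ is isomorphic to $(\mathbb{Z}_p,S_0)$ where $S_0:\mathbb{Z}_p\times\mathbb{Z}_p\to\mathbb{Z}_p\times\mathbb{Z}_p$ is one of the following maps: (i) $S_0(x,y)=(q_1^{-1}y+(1-q_2q_1^{-1})x+h,\ q_2x-q_1h)$ for some $q_1,q_2\in\mathbb{Z}_p^*$ with $q_1\neq q_2$ and some $h\in\mathbb{Z}_p$; (ii) $S_0(x,y)=(q_1^{-1}y+h,\ q_2x+(1-q_2q_1^{-1})y-q_2h)$ for some $q_1,q_2\in\mathbb{Z}_p^*$ with $q_1\neq q_2$ and some $h\in\mathbb{Z}_p$; (iii) $S_0(x,y)=(y+h_1,\ x+h_2)$ for some $(h_1,h_2)\in\mathbb{Z}_p^2$ with $(h_1,h_2)\neq(0,0)$.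
   Context: A braided set is a pair $(X,S)$ with $X$ a nonempty set and $S:X\times X\to X\times X$ a bijection such that $S_1S_2S_1=S_2S_1S_2$ on $X\times X\times X$, where $S_1=S\times \mathrm{id}$ and $S_2=\mathrm{id}\times S$. Write $S(x,y)=(g_x(y),f_y(x))$. It is nondegenerate if for each fixed $x$ the map $y\mapsto g_x(y)$ is a bijection of $X$ and for each fixed $y$ the map $x\mapsto f_y(x)$ is a bijection of $X$. A ''solution'' means a nondegenerate braided set. A solution $(X,S)$ is decomposable if there is a partition of $X$ into two disjoint nonempty subsets $X_1,X_2$ with $S(X_1\times X_1)\subset X_1\times X_1$ and $S(X_2\times X_2)\subset X_2\times X_2$; it is indecomposable if it is not decomposable. If $X$ is an abelian group, a solution $(X,S)$ is affine if $S(x,y)=(ax+by+h,\ cx+dy+t)$ for some $a,b,c,d\in\mathrm{End}(X)$ and $h,t\in X$. Solutions $(X,S)$ and $(X',S')$ are isomorphic if there is a bijection $\theta:X\to X'$ with $(\theta\times\theta)\circ S=S'\circ(\theta\times\theta)$. $\mathbb{Z}_p^*$ denotes the group of nonzero elements of $\mathbb{Z}_p$ under multiplication. *)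

(* Defs.v *)
From HB Require Import structures.
From mathcomp Require Import all_boot all_order all_algebra.
Set Implicit Arguments.
Unset Strict Implicit.
Unset Printing Implicit Defensive.
Import GRing.Theory.
Local Open Scope ring_scope.

Section BraidedSets.
Variables (X : Type) (S : X * X -> X * X).

(* S (x, y) = (g_x(y), f_y(x)); the subscript comes first in both. *)
Definition braid_g (x y : X) : X := (S (x, y)).1.
Definition braid_f (y x : X) : X := (S (x, y)).2.

(* X * X * X parses as (X * X) * X. *)
Definition braid1 (u : X * X * X) : X * X * X :=
  let: (x, y, z) := u in (S (x, y), z).
Definition braid2 (u : X * X * X) : X * X * X :=
  let: (x, y, z) := u in let: (y', z') := S (y, z) in (x, y', z').

Definition braided_set : Prop :=
  [/\ inhabited X, bijective S
    & braid1 \o braid2 \o braid1 =1 braid2 \o braid1 \o braid2].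

Definition nondegenerate : Prop :=
  (forall x, bijective (braid_g x)) /\ (forall y, bijective (braid_f y)).

Definition solution : Prop := braided_set /\ nondegenerate.

Definition braid_stable (Y : X -> Prop) : Prop :=
  forall x y, Y x -> Y y -> Y (S (x, y)).1 /\ Y (S (x, y)).2.

Definition decomposable : Prop :=
  exists X1 X2 : X -> Prop,
    [/\ forall x, X1 x \/ X2 x,
        forall x, ~ (X1 x /\ X2 x),
        exists x, X1 x,
        exists x, X2 x
      & braid_stable X1 /\ braid_stable X2].

Definition indecomposable : Prop := ~ decomposable.

End BraidedSets.

Definition isomorphic (X X' : Type)
    (S : X * X -> X * X) (S' : X' * X' -> X' * X') : Prop :=
  exists2 theta : X -> X', bijective theta &
    let theta2 (u : X * X) := (theta u.1, theta u.2) in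
    theta2 \o S =1 S' \o theta2.

Definition affine_solution (A : zmodType) (S : A * A -> A * A) : Prop :=
  solution S /\
  exists (a b c d : {additive A -> A}) (h t : A),
    forall x y, S (x, y) = (a x + b y + h, c x + d y + t).

(* Main.v *)
Require Import Defs.
From mathcomp Require Import all_boot all_order all_algebra.
From mathcomp Require Import all_fingroup all_solvable all_field all_character.
From mathcomp Require Import ring.
Set Implicit Arguments.
Unset Strict Implicit.
Unset Printing Implicit Defensive.
Import Order.TTheory GroupScope GRing.Theory Num.Theory.

(** Write [phi_b x = g_b (f_y x)] with [b = g_x y]; the maps [phi_b] form a rack
    of which all [g_x] are automorphisms, and [Gamma = <g, phi>] is transitive on
    the [p] points by indecomposability.  Its normal subgroup [A = <phi>] is
    therefore trivial or transitive.

    If [A] is transitive and [phi] is injective, [A] is generated by a conjugacy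
    class of prime size [p].  The class multiplication formula counts the
    factorisations [c1 * c2^-1 = u] with [c1], [c2] in that class and [u] of order
    [p] in [A'] as [p^2 / |A'|]: characters of degree divisible by [p] vanish at [u], and
    nonlinear characters of degree prime to [p] vanish on the class.  So [A'] has
    order [p] and [Gamma] acts by affine maps of [F_p].

    To control [g], let [rho_b w = w o g_{w^-1 b}] act on [Gamma].  These
    permutations satisfy the relations of the rack,
    [rho_b rho_x rho_b^-1 = rho_{phi_b x}], and left translation by [w] conjugates
    [rho_b] to [rho_{w b}].  For the affine rack the quotients [rho_x rho_0^-1] form
    a homomorphic image of [F_p], so that [g_x = rho_x 1] is affine in [x]; if
    [phi] is a constant [p]-cycle then [rho] is constant; and if [phi] is trivial
    the [rho_b] commute, and separating their [p]-parts shows that [g] is a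
    constant [p]-cycle. *)

(** * Groups generated by a conjugacy class of prime size *)

Section PrimeClass.
Local Open Scope ring_scope.

(** A Bezout relation [v * m = 1 + u * n] makes [x / m] an integral combination of [x] and
    [n * x / m]. *)
Lemma Aint_coprime_div (m n : nat) (x : algC) :
    (0 < m)%N -> coprime m n -> x \in Aint -> n%:R * x / m%:R \in Aint ->
  x / m%:R \in Aint.
Proof.
move=> m_gt0 co_mn Zx Znx.
have [u _ /dvdnP[v eq_uv]] := Bezoutl n m_gt0.
have nz_m : m%:R != 0 :> algC by rewrite pnatr_eq0 -lt0n.
suffices ->: x / m%:R = v%:R * x - u%:R * (n%:R * x / m%:R).
  by rewrite rpredB // rpredM ?rpred_nat.
have E : v%:R * m%:R = 1 + u%:R * n%:R :> algC.
  by rewrite -!natrM -eq_uv (eqnP co_mn) natrD.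
by rewrite -[v%:R](mulfK nz_m) E; field.
Qed.

(** The centralizer of [u] is [<[u]>], of prime order; a nontrivial [v] generates it too. *)
Lemma prime_cent1_gen (gT : finGroupType) (G : {group gT}) (p : nat) (u v : gT) :
    prime p -> u \in G -> #[u] = p -> #|'C_G[u]| = p -> v \in 'C_G[u] ->
  v != 1%g -> #|'C_G[v]| = p.
Proof.
move=> p_pr Gu ou cu Cv v1.
have Cu : u \in 'C_G[u] by rewrite inE Gu cent1id.
have Du : 'C_G[u] = <[u]>.
  by apply/eqP; rewrite eq_sym eqEcard cycle_subG Cu -orderE ou cu /=.
have Dv : <[v]> = <[u]>.
  have v_u : v \in <[u]> by rewrite -Du.
  apply/eqP; rewrite eqEcard cycle_subG v_u -!orderE ou.
  have : (#[v] %| p)%N by rewrite -ou order_dvdG.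
  by case/primeP: p_pr => _ H /H; rewrite order_eq1 (negPf v1) /= => /eqP->.
by rewrite -cent_cycle Dv cent_cycle.
Qed.

(* A character of p-defect zero vanishes on elements of order p; when these
   have centralizer of order p, the algebraic integers chi(v) / p have square
   norms summing to a rational integer below 1. *)
Lemma irr_defect0_vanish (gT : finGroupType) (G : {group gT}) (p : nat)
    (i : Iirr G) (u : gT) :
    prime p -> u \in G -> #[u] = p -> #|'C_G[u]| = p -> ~~ (p ^ 2 %| #|G|)%N ->
  (p %| Num.truncn ('chi_i 1%g))%N -> 'chi_i u = 0.
Proof.
move=> p_pr Gu ou cu p2G p_dv.
set m := Num.truncn _ in p_dv.
have Dm : 'chi_i 1%g = m%:R by rewrite truncnK ?Cnat_irr1.
have m_gt0 : (0 < m)%N by rewrite -ltC_nat -Dm irr1_gt0.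
have p_gt0 := prime_gt0 p_pr.
pose P := 'C_G[u]%G.
have nz_p : p%:R != 0 :> algC by rewrite pnatr_eq0 -lt0n.
have Zv v : v \in P -> v != 1%g -> 'chi_i v / p%:R \in Aint.
  move=> Pv v1; have Gv : v \in G by case/setIP: Pv.
  have cv := prime_cent1_gen p_pr Gu ou cu Pv v1.
  (* The class size is prime to [p], and its product with ['chi_i v / p] is an integer multiple of a
     central character value. *)
  apply: (@Aint_coprime_div p #|v ^: G|); rewrite ?Aint_irr //.
    rewrite prime_coprime //; apply: contra p2G => p_dvd.
    by rewrite -(Lagrange (subsetIl G 'C[v])) index_cent1 cv expnS expn1 dvdn_mul.
  have -> : #|v ^: G|%:R * 'chi_i v / p%:R =
            (m %/ p)%:R * (#|v ^: G|%:R * 'chi_i v / 'chi_i 1%g).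
    rewrite Dm -{2}(divnK p_dv) natrM invfM.
    have nz : (m %/ p)%:R != 0 :> algC.
      by rewrite pnatr_eq0 -lt0n divn_gt0 // dvdn_leq.
    by rewrite [in RHS]mulrCA [(m %/ p)%:R * _]mulrA divff // mul1r.
  by rewrite rpredM ?rpred_nat ?Aint_class_div_irr1.
have Pu : u \in P by rewrite inE Gu cent1id.
have u1 : u != 1%g by rewrite -order_gt1 ou prime_gt1.
pose s : algC := \sum_(v in P | v != 1%g) `|'chi_i v / p%:R| ^+ 2.
have s_Aint : s \in Aint.
  apply: rpred_sum => v /andP[Pv v1]; rewrite normCK rpredM ?Zv //.
  by rewrite Aint_aut Zv.
(* The norm of the restriction to [P] is a rational integer, and [#|P|] times it is
   [m ^ 2 + p ^ 2 * s]. *)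
have s_rat : s \in Crat.
  have : '['Res[P] 'chi_i] \in Crat.
    have Rchi : 'Res[P] 'chi_i \is a character by rewrite cfRes_char ?irr_char.
    by have /natrP[n ->] := Cnat_cfdot_char Rchi Rchi; rewrite rpred_nat.
  rewrite cfdotE (bigD1 1%g) //= cfResE ?subsetIl // Dm conj_natr ?natr_nat //.
  rewrite -[X in _ * (_ + X)](_ : s * p%:R ^+ 2 = _); last first.
    rewrite /s mulr_suml; apply: eq_bigr => v /andP[Pv _].
    by rewrite cfResE ?subsetIl // normrM exprMn normCK normfV normr_nat exprVn divfK ?expf_neq0.
  move=> H; have H1 : s =
      (((#|P|%:R)^-1 * (m%:R * m%:R + s * p%:R ^+ 2)) * #|P|%:R - m%:R * m%:R) / p%:R ^+ 2.
    by rewrite mulrAC mulVf ?neq0CG // mul1r addrC addKr mulfK ?expf_neq0.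
  rewrite H1; apply: rpred_div; last by apply/rpredX/rpred_nat.
  by apply: rpredB; apply: rpredM; rewrite ?rpred_nat.
have s_int := Cint_rat_Aint s_rat s_Aint.
have s_ge0 : 0 <= s by apply: sumr_ge0 => v _; rewrite exprn_ge0 ?normr_ge0.
(* Column orthogonality bounds the square norm of ['chi_i v] by the centralizer order [p]. *)
have chi_le v : v \in P -> v != 1%g -> `|'chi_i v / p%:R| ^+ 2 <= p%:R^-1.
  move=> Pv v1; have Gv : v \in G by case/setIP: Pv.
  have := second_orthogonality_relation v Gv.
  rewrite class_refl mulr1n (prime_cent1_gen p_pr Gu ou cu Pv v1) => Hs.
  have le1 : `|'chi_i v| ^+ 2 <= p%:R.
    rewrite -Hs (bigD1 i) //= -normCK lerDl sumr_ge0 // => j _.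
    by rewrite -normCK exprn_ge0 ?normr_ge0.
  rewrite normrM exprMn normfV normr_nat exprVn.
  by rewrite ler_pdivrMr ?exprn_gt0 ?ltr0n // expr2 mulKf.
have s_lt1 : s < 1.
  apply: (@le_lt_trans _ _ (\sum_(v in P | v != 1%g) p%:R^-1)).
    by apply: ler_sum => v /andP[Pv v1]; apply: chi_le.
  rewrite sumr_const -[p%:R^-1]mul1r -mulrnAl ltr_pdivrMr ?ltr0n // mul1r ltr_nat.
  rewrite -[X in (_ < X)%N]cu (cardD1 1%g (mem 'C_G[u])) group1 add1n ltnS.
  by apply/subset_leq_card/subsetP => v /andP[Pv v1]; apply/andP.
have s0 : s = 0.
  apply/eqP; apply: contraTT s_lt1 => nz_s.
  by have := norm_intr_ge1 s_int nz_s; rewrite ger0_norm // => /le_gtF ->.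
have s_ge0_in v : (v \in P) && (v != 1%g) -> 0 <= `|'chi_i v / p%:R| ^+ 2.
  by rewrite exprn_ge0 ?normr_ge0.
have /eqP := psumr_eq0P s_ge0_in s0 (introT andP (conj Pu u1)).
rewrite sqrf_eq0 normr_eq0 mulf_eq0 invr_eq0.
by rewrite (negPf nz_p) orbF => /eqP.
Qed.

(* Only linear characters contribute to the number of (x, y) in
   c ^: G * c^-1 ^: G with x * y = u, which is therefore p ^ 2 / #|G^`(1)|. *)
Lemma prime_class_der1 (gT : finGroupType) (G : {group gT}) (p : nat) (c u : gT) :
    prime p -> c \in G -> #|c ^: G| = p -> <<c ^: G>>%g = G ->
    u \in G^`(1)%g -> #[u] = p -> #|'C_G[u]| = p -> ~~ (p ^ 2 %| #|G|)%N ->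
  (#|G^`(1)%g| %| p ^ 2)%N.
Proof.
move=> p_pr Gc cardC genC G'u ou cu p2G.
have Gu : u \in G := subsetP (der_sub 1 G) u G'u.
have chi_c i : 'chi[G]_i \isn't a linear_char ->
    'chi_i c * 'chi_i c^-1%g * ('chi_i u)^* / 'chi_i 1%g = 0.
  move=> nlin; have [p_dv | p_ndv] := boolP (p %| Num.truncn ('chi_i 1%g))%N.
    by rewrite (irr_defect0_vanish p_pr Gu ou cu p2G p_dv) conjC0 mulr0 mul0r.
  (* Burnside's argument: the character vanishes at [c] unless [c] lies in its centre. In that case
     the class of [c] generates [G] inside the centre, and the degree is 1. *)
  have [Zc | nZc] := boolP (c \in 'Z('chi_i)%CF); last first.
    rewrite coprime_degree_support_cfcenter ?mul0r //.
    by rewrite cardC coprime_sym prime_coprime.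
  have Dchi : 'chi_i 1%g = (Num.truncn ('chi_i 1%g))%:R by rewrite truncnK ?Cnat_irr1.
  case/negP: nlin; rewrite qualifE/= irr_char.
  have sGZ : G \subset 'Z('chi_i)%CF.
    rewrite -{1}genC gen_subG class_sub_norm //.
    exact: normal_norm (cfcenter_normal _).
  have defG : 'Z('chi_i)%CF = G by apply/eqP; rewrite eqEsubset cfcenter_sub.
  have := irr1_bound i; rewrite defG indexgg => -[+ _].
  have := irr1_gt0 i; rewrite Dchi ltr0n -natrX lern1 pnatr_eq1.
  by case: (Num.truncn _) => [|[|m]].
have cardC' : #|c^-1%g ^: G| = p by rewrite -cardC -card_invg classVg invgK.
pose k x := enum_rank_in (classes1 G) (x ^: G).
have k_mem x : x \in G -> x \in enum_val (k x).
  by move=> Gx; rewrite enum_rankK_in ?mem_classes // class_refl.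
have := gring_classM_coef_sum_eq (k_mem c Gc) (k_mem c^-1%g (groupVr Gc)) (k_mem u Gu).
rewrite !enum_rankK_in ?mem_classes ?groupV // cardC cardC'.
rewrite (bigID [pred i | 'chi[G]_i \is a linear_char]) /= [X in _ + X]big1 // addr0.
rewrite (eq_bigr (fun=> 1)); last first.
  move=> i lin_i; rewrite lin_charV // mulfV ?lin_char_neq0 // mul1r lin_char1 // divr1.
  have : u \in cfker 'chi_i by rewrite (subsetP (lin_char_der1 lin_i)).
  by rewrite cfkerEchar ?irr_char // inE Gu lin_char1 //= => /eqP->; rewrite conjC1.
rewrite sumr_const card_lin_irr -(Lagrange (der_sub 1 G)).
set a := gring_classM_coef _ _ _; set d := #|G^`(1)%g|; set n := #|_ : _|.
have nz_n : n%:R != 0 :> algC by rewrite pnatr_eq0 -lt0n indexg_gt0.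
have nz_d : d%:R != 0 :> algC by rewrite pnatr_eq0 -lt0n cardG_gt0.
(* [E] equates [a] with [p * p / (d * n)] times the number [n] of linear characters. *)
move=> E; apply/dvdnP; exists a; apply/eqP; rewrite -(eqr_nat algC) natrM E !natrM.
by apply/eqP; field; apply/andP.
Qed.
End PrimeClass.

(** * Permutation groups of prime degree *)

Local Open Scope group_scope.

Lemma prime_dvd_fact p n : prime p -> p %| n`! -> p <= n.
Proof.
move=> p_pr; elim: n => [|n IHn]; first by rewrite dvdn1 => /eqP p1; rewrite p1 in p_pr.
by rewrite factS Euclid_dvdM // => /orP[/dvdn_leq->|/IHn/leqW].
Qed.

Lemma card_prime_inhabited (X : finType) p : prime p -> #|X| = p -> inhabited X.
Proof.
by move/prime_gt0 => p_gt0 cX; move: p_gt0; rewrite -cX => /card_gt0P[x _]; exists.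
Qed.

Section PrimeDegree.
Variables (X : finType) (p : nat).
Hypotheses (p_pr : prime p) (cardX : #|X| = p).
Implicit Types (N G : {group {perm X}}) (u t : {perm X}).

Lemma perm_p2_ndvd G : ~~ (p ^ 2 %| #|G|).
Proof.
apply/negP => /dvdn_trans/(_ (cardSg (subsetT G))).
rewrite (card_Sym X) cardX; have p_gt0 := prime_gt0 p_pr.
rewrite -{2}(prednK p_gt0) factS (prednK p_gt0) expnS expn1 dvdn_pmul2l //.
by move/(prime_dvd_fact p_pr); rewrite leqNgt ltn_predL p_gt0.
Qed.

(** Orbits of a common size partition the [p] points, so this size is 1 or [p]. *)
Lemma orbit_prime_trans G (x : X) :
  (forall y, #|orbit 'P G y| = #|orbit 'P G x|) ->
  G :=: 1 \/ [transitive G, on [set: X] | 'P].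
Proof.
move=> card_orb; have actG : [acts G, on [set: X] | 'P] by apply/actsP => ? _ ?; rewrite !inE.
have := acts_sum_card_orbit actG; rewrite cardsT cardX.
rewrite (eq_bigr (fun=> #|orbit 'P G x|)); last by move=> _ /imsetP[y _ ->].
rewrite sum_nat_const => E.
have : #|orbit 'P G x| %| p by rewrite -E dvdn_mull.
case/primeP: p_pr => _ H /H{H}/orP[] /eqP cx.
  left; apply/trivgP/subsetP => g Gg; rewrite inE; apply/eqP/permP => y.
  have /eqP := card_orb y; rewrite cx => /eqP/card_orbit1 oy.
  have : g y \in orbit 'P G y by apply: mem_orbit.
  by rewrite oy inE perm1 => /eqP.
right; apply/imsetP; exists x => //; apply/esym/eqP.
by rewrite eqEcard subsetT cardsT cardX cx /=.
Qed.

(** Elements of [G] carry orbits of [N] to orbits of [N], so these have equal sizes. *)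
Lemma normal_prime_trans N G :
    N <| G -> [transitive G, on [set: X] | 'P] ->
  N :=: 1 \/ [transitive N, on [set: X] | 'P].
Proof.
move=> nNG trG; have [x0] := card_prime_inhabited p_pr cardX.
apply: (@orbit_prime_trans N x0) => y.
have [g Gg ->] := atransP2 trG (in_setT x0) (in_setT y).
rewrite -(card_imset (mem (orbit 'P N x0)) (@perm_inj _ g)); apply: eq_card => z.
have := orbit_conjsg 'P N g x0 (g^-1 z).
rewrite (normsP (normal_norm nNG)) // /= !apermE permKV => ->.
apply/idP/imsetP => [H | [t Ht ->]]; last by rewrite permK.
by exists (g^-1 z) => //; rewrite permKV.
Qed.

Lemma trans_order_p N : [transitive N, on [set: X] | 'P] ->
  exists2 u, u \in N & #[u] = p.
Proof.
by move/atrans_dvd; rewrite cardsT cardX => /(Cauchy p_pr)[u Nu ou]; exists u.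
Qed.

Lemma cycle_trans u : #[u] = p -> [transitive <[u]>, on [set: X] | 'P].
Proof.
move=> ou.
have /subsetPn[x _ ux] : ~~ ([set: X] \subset [set x | u x == x]).
  apply: contraL (prime_gt1 p_pr) => /subsetP H.
  rewrite -ou order_gt1 negbK; apply/eqP/permP => x; rewrite perm1.
  by apply/eqP; have := H x; rewrite !inE => /(_ isT).
apply/imsetP; exists x => //; apply/esym/eqP; rewrite eqEcard subsetT cardsT cardX /=.
have : #|orbit 'P <[u]> x| %| p by rewrite -ou orderE card_orbit dvdn_indexg.
case/primeP: p_pr => _ H /H{H}/orP[] /eqP; last by move->.
move/card_orbit1 => ox; have : u x \in orbit 'P <[u]> x by apply/mem_orbit/cycle_id.
by rewrite ox inE => /eqP ux'; rewrite inE ux' eqxx in ux.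
Qed.

(** Some [g] in [N] agrees with [t] at one point. Both centralize the transitive group [N], so they
    agree everywhere. *)
Lemma trans_abelian_cent_sub N t :
    [transitive N, on [set: X] | 'P] -> abelian N -> t \in 'C(N) -> t \in N.
Proof.
move=> trN abN /centP ct; have [x0] := card_prime_inhabited p_pr cardX.
have [g Ng Dg] := atransP2 trN (in_setT x0) (in_setT (t x0)).
suffices -> : t = g by [].
apply/permP => y; have [h Nh ->] := atransP2 trN (in_setT x0) (in_setT y).
rewrite /= in Dg *; rewrite !apermE in Dg *. 
rewrite -!permM -(ct h Nh) [LHS]permM Dg -permM.
by have /centsP/(_ h Nh g Ng) -> := abN.
Qed.

Lemma cent_order_p u t : #[u] = p -> (t \in 'C[u]) = (t \in <[u]>).
Proof.
move=> ou; apply/idP/idP; last first.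
  by move=> tu; rewrite -cent_cycle; have := cycle_abelian u => /subsetP; apply.
rewrite -cent_cycle; apply: trans_abelian_cent_sub (cycle_trans ou) _.
exact: cycle_abelian.
Qed.

(** The point [(u ^+ i) x0] gets coordinate [i]. If [t] conjugates [u] to [u ^+ k], it is affine of
    slope [k]. *)
Lemma order_p_coordinate u : #[u] = p ->
  exists theta : X -> 'F_p,
    [/\ bijective theta,
        forall x, theta (u x) = (theta x + 1)%R
      & forall t, t \in 'N(<[u]>) -> exists lam del : 'F_p,
          lam != 0%R /\ forall x, theta (t x) = (lam * theta x + del)%R].
Proof.
move=> ou; have [x0] := card_prime_inhabited p_pr cardX.
pose psi (i : 'F_p) : X := (u ^+ (i : nat)) x0.
have psiE n : psi (n%:R)%R = (u ^+ n) x0.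
  by rewrite /psi (val_Fp_nat p_pr) expg_mod // -ou expg_order.
have psiD i n : psi (i + n%:R)%R = (u ^+ n) (psi i).
  by rewrite -[i]natr_Zp -natrD !psiE expgD permM.
have psi_surj x : exists i, psi i = x.
  have [g /cycleP[n ->] ->] := atransP2 (cycle_trans ou) (in_setT x0) (in_setT x).
  by exists (n%:R)%R; rewrite psiE.
have psi_bij : bijective psi.
  apply: inj_card_bij; last by rewrite (card_Fp p_pr) cardX.
  move=> i j eq_ij; have ltp (k : 'F_p) : k < p by apply: leq_trans (ltn_ord k) _; rewrite Fp_cast.
  have /eqP : u ^+ i = u ^+ j; last first.
    by rewrite eq_expg_mod_order ou !modn_small ?ltp // => /eqP/val_inj.
  apply/permP => x; have [k <-] := psi_surj x.
  have expC (m n : nat) y : (u ^+ m) ((u ^+ n) y) = (u ^+ n) ((u ^+ m) y).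
    by rewrite -!permM -!expgD addnC.
  by rewrite expC [RHS]expC; congr (_ _).
have [theta thetaK psiK] := psi_bij.
have thetaD n x : theta ((u ^+ n) x) = (theta x + n%:R)%R.
  by rewrite -{1}[x]psiK -psiD thetaK.
exists theta; split; first by exists psi.
  by move=> x; rewrite -(thetaD 1%N).
move=> t /normP nt; have : u ^ t \in <[u]> by rewrite -nt memJ_conjg cycle_id.
case/cycleP => k Dk.
have tE x : theta (t x) = (k%:R * theta x + theta (t x0))%R.
  rewrite -{1}[x]psiK /psi -permM conjgC permM conjXg Dk -expgM thetaD natrM natr_Zp.
  exact: addrC.
exists (k%:R)%R, (theta (t x0)); split=> //.
have theta_inj : injective theta by apply: can_inj psiK.
apply/eqP => k0; have /eqP := oner_neq0 'F_p; apply.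
rewrite -[1%R]thetaK -[0%R]thetaK; congr theta; apply: (@perm_inj _ t).
by apply: theta_inj; rewrite tE [RHS]tE k0 !mul0r.
Qed.
End PrimeDegree.

(** * The representation of the rack by permutations of its automorphisms *)

(** As products in [{perm X}] compose from left to right, on permutations this is left translation
    for composition of maps. *)
Definition rtrans (gT : finGroupType) (g : gT) : {perm gT} := perm (mulIg g).

Lemma rtransE (gT : finGroupType) (g v : gT) : rtrans g v = v * g.
Proof. by rewrite permE. Qed.

Lemma rtransX (gT : finGroupType) (g : gT) n : rtrans g ^+ n = rtrans (g ^+ n).
Proof.
elim: n => [|n IHn]; apply/permP => v; first by rewrite !rtransE mulg1 perm1.
by rewrite expgS permM IHn !rtransE expgS mulgA.
Qed.

Lemma Fp_additiveE p (e : 'F_p -> 'F_p) : {morph e : x y / (x + y)%R} ->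
  forall x, e x = (x * e 1)%R.
Proof.
move=> eD x; have e0 : e 0%R = 0%R by apply: (addrI (e 0%R)); rewrite -eD !addr0.
have en n : e (n%:R)%R = (n%:R * e 1)%R.
  elim: n => [|n IHn]; first by rewrite e0 mul0r.
  by rewrite mulrSr eD IHn mulrDl mul1r.
by rewrite -{1}[x]natr_Zp en natr_Zp.
Qed.

(** * Affine racks realised by conjugation in a group *)

Section AffineRack.
Local Open Scope ring_scope.
Variables (p : nat) (gT : finGroupType) (R : 'F_p -> gT) (al : 'F_p).
Hypotheses (al0 : al != 0) (al1 : al != 1).
Hypothesis RJ : forall x b, (R x ^ R b)%g = R (al * x + (1 - al) * b).

Let T x := ((R 0)^-1 * R x)%g.

Let al1' : 1 - al != 0. Proof. by rewrite subr_eq0 eq_sym. Qed.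

(** Conjugation by the inverse of [R 0] divides the index by [al]; then [R b] scales it back and
    adds [(1 - al) * b]. *)
Lemma affine_rackJ x b : (R x ^ T b)%g = R (x + (1 - al) * b).
Proof.
have -> : R x = (R (x / al)%R ^ R 0)%g by rewrite RJ mulr0 addr0 mulrC divfK.
by rewrite /T conjgM conjgK RJ mulrC divfK.
Qed.

(* T b shifts the generators by (1 - al) b, so each T b is a power of a fixed
   T b times an element of the centre. *)
Lemma affine_rack_commute a b : commute (T a) (T b).
Proof.
pose t := T (1 - al)^-1; pose n (b : 'F_p) : nat := (1 - al) * b.
have tJ x k : (R x ^ (t ^+ k))%g = R (x + k%:R).
  elim: k => [|k IHk]; first by rewrite conjg1 addr0.
  by rewrite expgSr conjgM IHk affine_rackJ mulfV // -addrA -natr1.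
pose z b := (T b * (t ^+ n b)^-1)%g.
have zC c x : commute (z c) (R x).
  apply/commute_sym/commgP/conjg_fixP.
  rewrite /z conjgM affine_rackJ.
  have -> : R (x + (1 - al) * c) = (R x ^ (t ^+ n c))%g by rewrite tJ natr_Zp.
  by rewrite conjgK.
have zT c d : commute (z c) (T d) by apply: commuteM; first apply: commuteV; apply: zC.
have TE c : T c = (z c * t ^+ n c)%g by rewrite mulgKV.
have tT c : commute t (T c).
  by rewrite TE; apply: commuteM; [apply/commute_sym/zT | apply: commuteX].
rewrite [T b]TE; apply: commuteM; first exact/commute_sym/zT.
by apply: commuteX; apply: commute_sym.
Qed.

(** Conjugation by [T b] turns [T c] into the quotient of [T (c + b')] by [T b'], where
    [b' = (1 - al) * b]; by commutation it also fixes [T c]. *)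
Lemma affine_rackD x y : T (x + y) = (T x * T y)%g.
Proof.
have TJ b c : (T c ^ T b)%g = ((T ((1 - al) * b)%R)^-1 * T (c + (1 - al) * b)%R)%g.
  by rewrite {1}/T conjMg conjVg !affine_rackJ add0r /T invMg invgK mulgA mulgK.
have /conjg_fixP := introT commgP (affine_rack_commute y (x / (1 - al))).
rewrite TJ mulrC divfK // => /(congr1 (mulg (T x))).
by rewrite mulKVg addrC.
Qed.
End AffineRack.

Section Rho.
Variables (X : finType) (N : {group {perm X}}) (G Phi : X -> {perm X}).
Hypotheses (GN : forall x, G x \in N)
  (PhiN : forall v x, v \in N -> Phi x ^ v = Phi (v x))
  (G_Phi : forall x b, G ((G x)^-1 b) * G x = G ((G b)^-1 (Phi b x)) * G b)
  (T_inj : injective (fun x => (G x)^-1 x)).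

(* In [{perm X}], [a * b] is the map [b o a]; permutations outside [N]
   need not be automorphisms of the rack, and [rho_fun] fixes them. *)
Definition rho_fun b v : {perm X} := if v \in N then G (v^-1 b) * v else v.

Lemma rho_fun_in b v : (rho_fun b v \in N) = (v \in N).
Proof. by rewrite /rho_fun; case: ifP => // Nv; rewrite groupM. Qed.

(** For [v] in [N], the image [u = G z * v], with [z = v^-1 b], determines [u^-1 b = (G z)^-1 z],
    hence [z] by [T_inj], hence [v]. *)
Lemma rho_fun_inj b : injective (rho_fun b).
Proof.
move=> v w E; have := congr1 (mem N) E; rewrite /= !rho_fun_in.
move: E; rewrite /rho_fun; case: ifP => Nv; case: ifP => // Nw E _.
suffices Ez : v^-1 b = w^-1 b by move: E; rewrite Ez => /mulgI.
apply: T_inj; set z := v^-1 b; apply: (@perm_inj _ (G z)).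
apply: (@perm_inj _ v); rewrite permKV -[RHS]permM E -/z permM.
by rewrite permKV !permKV.
Qed.

Definition rho b : {perm {perm X}} := perm (@rho_fun_inj b).

Lemma rhoE b v : v \in N -> rho b v = G (v^-1 b) * v.
Proof. by rewrite permE /rho_fun => ->. Qed.

Lemma rho_in b v : (rho b v \in N) = (v \in N).
Proof. by rewrite permE rho_fun_in. Qed.

Lemma rho_out b v : v \notin N -> rho b v = v.
Proof. by rewrite permE /rho_fun => /negPf->. Qed.

Lemma rho1 b : rho b 1 = G b.
Proof. by rewrite rhoE ?group1 // invg1 perm1 mulg1. Qed.

Lemma rhoJ_rtrans b g : g \in N -> rho b ^ rtrans g = rho (g b).
Proof.
move=> Ng; apply/permP => v; rewrite -{1}[v](mulgKV g) -[v * _ * g]rtransE permJ.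
have [Nv | nNv] := boolP (v \in N); last first.
  by rewrite !rho_out ?groupMr ?groupV // rtransE mulgKV.
by rewrite !rhoE ?groupM ?groupV // rtransE invMg invgK permM mulgA mulgKV.
Qed.

(** At [v] in [N] this is [G_Phi] for the points [v^-1 x] and [v^-1 b], multiplied by [v]. *)
Lemma rhoJ_rho x b : rho x ^ rho b = rho (Phi b x).
Proof.
apply: (mulgI (rho b)); rewrite -conjgC; apply/permP => v; rewrite !permM.
have [Nv | nNv] := boolP (v \in N); last by rewrite !rho_out.
rewrite !rhoE ?groupM // !invMg !permM !mulgA.
have -> : v^-1 (Phi b x) = Phi (v^-1 b) (v^-1 x).
  by rewrite -(PhiN b (groupVr Nv)) permJ.
by rewrite G_Phi.
Qed.

(** * Orbit of the identity under an equivariant family *)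

Section OrbitGroup.
Variable d : X -> {perm {perm X}}.
Hypotheses (dN : forall b v, (d b v \in N) = (v \in N))
  (dJ : forall b g, g \in N -> d b ^ rtrans g = d (g b)).

Let D := <<[set d b | b : X]>>.
Let O := <<[set d b 1 | b : X]>>.

Lemma equivariantE b v : v \in N -> d b v = d (v^-1 b) 1 * v.
Proof.
move=> Nv; rewrite -rtransE -permJ dJ ?permKV //.
by rewrite rtransE mul1g.
Qed.

Lemma orbit1_gen_sub : O \subset N.
Proof. by rewrite gen_subG; apply/subsetP => _ /imsetP[b _ ->]; rewrite dN group1. Qed.

(** On [N], [d b] multiplies on the left by a generator of [O], and each generator occurs at each
    [w], since [d b 1 * w = d (w b) w]. *)
Lemma orbit1_gen : orbit 'P D 1 = O.
Proof.
apply/eqP; rewrite eqEsubset; apply/andP; split.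
  rewrite acts_sub_orbit ?group1 // gen_subG; apply/subsetP => _ /imsetP[b _ ->].
  rewrite !inE /=; apply/subsetP => v Ov; rewrite inE /= apermE.
  have Nv : v \in N := subsetP orbit1_gen_sub v Ov.
  by rewrite equivariantE // groupM // mem_gen // imset_f.
apply/subsetP => _ /gen_prodgP[n [c c_in ->]].
elim: n c c_in => [|n IHn] c c_in; first by rewrite big_ord0 orbit_refl.
rewrite big_ord_recl /=; set w := \prod_(i < n) _.
have Ow : w \in orbit 'P D 1 by apply: IHn => i; apply: c_in.
have Nw : w \in N.
  apply: group_prod => i _; have /imsetP[b _ ->] := c_in (lift ord0 i).
  by rewrite dN group1.
have /imsetP[b _ ->] := c_in ord0.
have -> : d b 1 * w = d (w b) w by rewrite [RHS]equivariantE // permK.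
by apply: orbit_trans Ow; apply/mem_orbit/mem_gen/imset_f.
Qed.

Lemma card_orbit1_gen : #|O| %| #|D|.
Proof. by rewrite -orbit1_gen card_orbit dvdn_indexg. Qed.
End OrbitGroup.

(** * The case of commuting [rho b] *)

Section Commuting.
Variable p : nat.
Hypotheses (p_pr : prime p) (cardX : #|X| = p).
Hypotheses (genN : <<[set G x | x : X]>> = N)
  (trN : [transitive N, on [set: X] | 'P])
  (rhoC : forall x b, rho x ^ rho b = rho x).

Let E := <<[set rho b | b : X]>>.

Lemma constt_rhoN pi b v : ((rho b).`_pi v \in N) = (v \in N).
Proof.
have Nrho : rho b \in 'N(N | 'P) by apply/astabsP => w; rewrite /= apermE rho_in.
have : (rho b).`_pi \in 'N(N | 'P) by rewrite groupX.
by move/astabs_act => /(_ v); rewrite /= apermE.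
Qed.

Lemma constt_rhoJ pi b g : g \in N -> (rho b).`_pi ^ rtrans g = (rho (g b)).`_pi.
Proof. by move=> Ng; rewrite -consttJ rhoJ_rtrans. Qed.

Lemma abelian_gen_rho : abelian E.
Proof.
rewrite abelian_gen; apply/centsP => _ /imsetP[x _ ->] _ /imsetP[b _ ->].
by apply/commgP/conjg_fixP.
Qed.

Lemma pgroup_gen_constt_rho (pi : nat_pred) : pi.-group <<[set (rho b).`_pi | b : X]>>.
Proof.
apply: (pgroupS _ (pcore_pgroup pi E)); rewrite gen_subG.
apply/subsetP => _ /imsetP[b _ ->].
rewrite (mem_normal_Hall (nilpotent_pcore_Hall pi (abelian_nil abelian_gen_rho))) ?pcore_normal //.
  exact: p_elt_constt.
by rewrite groupX // mem_gen // imset_f.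
Qed.

Lemma pgroup_orbit_constt_rho (pi : nat_pred) :
  pi.-group <<[set (rho b).`_pi 1 | b : X]>>.
Proof.
apply: pnat_dvd (pgroup_gen_constt_rho pi).
exact: card_orbit1_gen (constt_rhoN pi) (constt_rhoJ pi).
Qed.

(* The orbits of 1 under the p-parts and the p'-parts of rho are subgroups O and H
   of N.  Right translations by O centralize the p-parts modulo the stabilizer of
   1, so s is constant; then s normalizes H, which is a normal p'-subgroup of N,
   hence trivial. *)
Lemma commuting_rho_constant : exists2 u, #[u] = p & forall b, G b = u.
Proof.
pose s b := (rho b).`_p 1; pose h b := (rho b).`_p^' 1.
pose O := <<[set s b | b : X]>>; pose H := <<[set h b | b : X]>>.
have pO : p.-group O := pgroup_orbit_constt_rho p.
have pH : p^'.-group H := pgroup_orbit_constt_rho p^'.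
have sON : O \subset N := orbit1_gen_sub (constt_rhoN p).
have sHN : H \subset N := orbit1_gen_sub (constt_rhoN p^').
have Ns b : s b \in N by rewrite constt_rhoN group1.
have Nh b : h b \in N by rewrite constt_rhoN group1.
have sE b v : v \in N -> (rho b).`_p v = s (v^-1 b) * v.
  exact: (equivariantE (constt_rhoJ p)).
have hE b v : v \in N -> (rho b).`_p^' v = h (v^-1 b) * v.
  exact: (equivariantE (constt_rhoJ p^')).
have rho_sh b : rho b = (rho b).`_p^' * (rho b).`_p.
  rewrite -{1}(consttC p (rho b)).
  by have /centsP := cycle_abelian (rho b); apply; apply: cycle_constt.
(* Applying the two parts of [rho b] to 1 in either order factors [G b] in two ways. *)
have Gsh b : G b = s ((h b)^-1 b) * h b by rewrite -rho1 rho_sh permM; apply: sE (Nh b).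
have Ghs b : G b = h ((s b)^-1 b) * s b.
  by rewrite -rho1 -(consttC p (rho b)) permM; apply: hE (Ns b).
have p_dvN : p %| #|N| by have := atrans_dvd trN; rewrite cardsT cardX.
have nt_s : exists b, s b != 1.
  apply/existsP; move: (p_dvN); apply: contraLR; rewrite negb_exists => /forallP s1.
  rewrite -p'natE // (pnat_dvd _ pH) // cardSg // -genN gen_subG.
  apply/subsetP => _ /imsetP[b _ ->].
  have /negPn/eqP sb1 := s1 ((h b)^-1 b).
  by rewrite Gsh sb1 mul1g mem_gen // imset_f.
have cardO : #|O| = p.
  have := card_pgroup pO; case Dk: (logn p #|O|) => [|[|k]] // cO.
    have O1 : O = [1] by apply/eqP; rewrite trivg_card1 cO.
    have [b /negPf nt_sb] := nt_s.
    have : s b \in O by rewrite mem_gen ?imset_f.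
    by rewrite O1 inE nt_sb.
  case/negP: (perm_p2_ndvd p_pr cardX O).
  by rewrite cO dvdn_exp2l.
have s_inv v b : v \in O -> s (v b) = s b.
  move=> Ov; have Nv := subsetP sON v Ov.
  (* [M] is a p-group acting on the [p] elements of [O]. The stabilizer [M1] of 1 has index [p], so
     it is normal and contains all commutators. *)
  pose D := <<[set (rho b).`_p | b : X]>>; pose M := D <*> <[rtrans v]>.
  have Ds x : (rho x).`_p \in D by apply/mem_gen/imsetP; exists x.
  have nDv : <[rtrans v]> \subset 'N(D).
    rewrite cycle_subG; apply: (subsetP (norms_gen (subxx _))).
    rewrite inE; apply/subsetP => _ /imsetP[_ /imsetP[x _ ->] ->].
    by rewrite constt_rhoJ //; apply/imsetP; exists (v x).
  have pM : p.-group M.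
    rewrite /M norm_joinEr // pgroupM pgroup_gen_constt_rho /=.
    rewrite /pgroup -orderE; apply: (pnat_dvd _ (mem_p_elt pO Ov)).
    rewrite order_dvdn rtransX expg_order; apply/eqP/permP => w.
    by rewrite rtransE mulg1 perm1.
  have orbD : orbit 'P D 1 = O := orbit1_gen (constt_rhoN p) (constt_rhoJ p).
  have orbM : orbit 'P M 1 = O.
    apply/eqP; rewrite eqEsubset; apply/andP; split.
      rewrite acts_sub_orbit ?group1 // join_subG; apply/andP; split.
        by rewrite -orbD; apply: acts_orbit (subsetT _).
      rewrite cycle_subG; apply/astabsP => w; rewrite /= apermE rtransE.
      by rewrite groupMr.
    rewrite -orbD.
    by apply: imsetS; apply: joing_subl.
  pose M1 := 'C_M[1 | 'P].
  have iM1 : #|M : M1| = p by rewrite -card_orbit orbM.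
  have nM1 : M1 <| M.
    by apply: (p_maximal_normal pM); apply: p_index_maximal; rewrite ?subsetIl ?iM1.
  have M'1 : M^`(1) \subset M1.
    apply: der1_min; first exact: normal_norm.
    by apply/cyclic_abelian/prime_cyclic; rewrite card_quotient ?normal_norm ?iM1.
  have Mv : rtrans v \in M by rewrite mem_gen // inE cycle_id orbT.
  have Mb : (rho b).`_p \in M by rewrite mem_gen // inE Ds.
  have : [~ ((rho b).`_p)^-1, rtrans v]^-1 \in M1.
    by rewrite groupV (subsetP M'1) // mem_commg ?groupV.
  case/setIP => _ /astab1P /=; rewrite apermE => E1.
  rewrite /s -(constt_rhoJ p) //.
  have -> : (rho b).`_p ^ rtrans v = [~ ((rho b).`_p)^-1, rtrans v]^-1 * (rho b).`_p.
    by rewrite commgEl invMg conjVg !invgK mulgKV.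
  by rewrite permM E1.
have [b0 nt_sb0] := nt_s.
have trO : [transitive O, on [set: X] | 'P].
  have p_dvO : p %| #|O| by rewrite cardO.
  have [u Ou ou] := Cauchy p_pr p_dvO.
  suffices -> : O = <[u]> by apply: cycle_trans ou.
  by apply/eqP; rewrite eq_sym eqEcard cycle_subG Ou cardO -orderE ou /=.
have s_const b : s b = s b0.
  have [v Ov ->] := atransP2 trO (in_setT b0) (in_setT b).
  by rewrite /= apermE s_inv.
set s0 := s b0 in nt_sb0 s_const.
(* With [s] constant, equating the two factorisations shows that conjugation permutes the [h b]. *)
have hJ b : h b ^ s0^-1 = h (s0^-1 b).
  by have := Ghs b; rewrite Gsh !s_const => Eb; rewrite conjgE invgK mulgA Eb mulgK.
have Ns0 : s0 \in 'N(H).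
  rewrite -groupV; apply: (subsetP (norms_gen (subxx _))).
  rewrite inE; apply/subsetP => _ /imsetP[_ /imsetP[b _ ->] ->].
  by rewrite hJ imset_f.
have nHN : H <| N.
  rewrite /normal sHN -genN gen_subG; apply/subsetP => _ /imsetP[b _ ->].
  rewrite Gsh s_const groupM //; apply: (subsetP (normG _)).
  by rewrite mem_gen // imset_f.
have H1 : H = 1.
  have [//|/atrans_dvd] := normal_prime_trans p_pr cardX nHN trN.
  rewrite cardsT cardX => p_dvH; move: pH; rewrite /pgroup p'natE //.
  by rewrite p_dvH.
exists s0 => [|b].
  have : #[s0] %| p by rewrite -cardO order_dvdG // mem_gen // imset_f.
  by case/primeP: p_pr => _ dv /dv; rewrite order_eq1 (negPf nt_sb0) => /eqP.
have : h b \in H by rewrite mem_gen // imset_f.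
by rewrite H1 inE Gsh s_const => /eqP->; rewrite mulg1.
Qed.
End Commuting.

(** * The case of an affine rack *)

Section AffineCase.
Variables (p : nat) (theta : X -> 'F_p) (al : 'F_p).
Hypotheses (theta_bij : bijective theta) (al0 : al != 0%R) (al1 : al != 1%R).
Hypothesis N_affine : forall v, v \in N -> exists lam del : 'F_p,
  lam != 0%R /\ forall x, theta (v x) = (lam * theta x + del)%R.
Hypothesis PhiE : forall b x, theta (Phi b x) = (al * theta x + (1 - al) * theta b)%R.

(* The elements o i = T i 1 satisfy o j * o i = o (i + lam * j), where lam is the
   slope of o i; if lam were not 1, a suitable j would give o i = 1. *)
Lemma affine_rack_G_affine : exists gam kap h : 'F_p,
  gam != 0%R /\ forall x y, theta (G x y) = (gam * theta y + kap * theta x + h)%R.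
Proof.
have [psi thetaK psiK] := theta_bij.
pose R i := rho (psi i); pose T i := (R 0%R)^-1 * R i.
have RJ i j : R i ^ R j = R (al * i + (1 - al) * j)%R.
  by rewrite /R rhoJ_rho; congr rho; rewrite -[LHS]thetaK PhiE !psiK.
have TD i j : T (i + j)%R = T i * T j := affine_rackD al0 al1 RJ i j.
have TN i v : (T i v \in N) = (v \in N).
  by rewrite /T permM rho_in -[in RHS](permKV (R 0%R) v) rho_in.
pose o i := T i 1.
have No i : o i \in N by rewrite TN group1.
(* Conjugation by [rtrans w] sends [T k] to [T (lam * k)]: the shift [del] cancels because [T] is
   additive. *)
have TE i w lam del : w \in N -> lam != 0%R ->
    (forall x, theta (w x) = lam * theta x + del)%R -> T i w = o (i / lam)%R * w.
  move=> Nw lam0 wE.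
  have Rw k : R k ^ rtrans w = R (lam * k + del)%R.
    by rewrite /R rhoJ_rtrans //; congr rho; rewrite -[LHS]thetaK wE psiK.
  have Tw k : T k ^ rtrans w = T (lam * k)%R.
    rewrite /T conjMg conjVg !Rw mulr0 add0r.
    have RT m : R m = R 0%R * T m by rewrite mulKVg.
    by rewrite (RT (_ + _)%R) addrC TD (RT del) invMg -mulgA !mulKg.
  have -> : T i = T (i / lam)%R ^ rtrans w by rewrite Tw mulrC divfK.
  by rewrite -{2}[w]mul1g -[1 * w]rtransE permJ rtransE.
have oE i : exists del, forall x, theta (o i x) = (theta x + del)%R.
  have [lam [del [lam0 oiE]]] := N_affine (No i).
  suffices lam1 : lam = 1%R by exists del => x; rewrite oiE lam1 mul1r.
  apply/eqP; apply: contraT => nlam1.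
  have li1 : (1 - lam)%R != 0%R by rewrite subr_eq0 eq_sym.
  (* This solves [j / lam = i + j], so that [o (i + j) = o (i + j) * o i]. *)
  pose j := (i * lam / (1 - lam))%R.
  have : o (i + j)%R = o (j / lam)%R * o i by rewrite {1}/o TD permM (TE _ _ _ _ (No i) lam0 oiE).
  have -> : (j / lam = i + j)%R by rewrite /j; field; rewrite li1 lam0.
  move/(canLR (mulKg _)); rewrite mulVg => oi1.
  case/negP: nlam1; apply/eqP.
  have E0 := oiE (psi 0%R); have E1 := oiE (psi 1%R).
  rewrite -oi1 !perm1 !psiK mulr0 add0r in E0 E1.
  by rewrite E1 -E0 addr0 mulr1.
pose eps i : 'F_p := theta (o i (psi 0%R)).
have oP i x : theta (o i x) = (theta x + eps i)%R.
  by have [del E] := oE i; rewrite /eps !E psiK add0r.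
have epsE : forall i, eps i = (i * eps 1)%R.
  apply: Fp_additiveE => i j; rewrite [LHS]/eps {1}/o TD permM.
  rewrite (TE _ _ 1%R (eps i) (No i) (oner_neq0 _)); last by move=> x; rewrite mul1r oP.
  by rewrite divr1 permM !oP psiK add0r addrC.
have [gam [del [gam0 G0E]]] := N_affine (GN (psi 0%R)).
exists gam, (eps 1)%R, del; split=> // x y.
have -> : G x = o (theta x / gam)%R * G (psi 0%R).
  rewrite -(TE _ _ _ _ (GN _) gam0 G0E) -[in RHS]rho1 -permM mulKVg.
  by rewrite /R thetaK rho1.
by rewrite permM G0E oP epsE; field.
Qed.
End AffineCase.
End Rho.

(** * Affine coordinates *)

Section Coordinates.
Variables (X : finType) (p : nat) (G Phi : X -> {perm X}).
Hypotheses (p_pr : prime p) (cardX : #|X| = p).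

Let Gam := <<[set G x | x : X] :|: [set Phi x | x : X]>>%G.

Hypotheses (PhiG : forall x y, Phi y ^ G x = Phi (G x y))
  (PhiPhi : forall x y, Phi y ^ Phi x = Phi (Phi x y))
  (G_Phi : forall x b, G ((G x)^-1 b) * G x = G ((G b)^-1 (Phi b x)) * G b)
  (T_inj : injective (fun x => (G x)^-1 x))
  (trGam : [transitive Gam, on [set: X] | 'P]).

Lemma G_Gam x : G x \in Gam.
Proof. by rewrite mem_gen // inE imset_f. Qed.

Lemma Phi_Gam x : Phi x \in Gam.
Proof. by rewrite mem_gen // inE orbC imset_f. Qed.

(** The permutations [v] satisfying this for all [x] form a group containing the generators of
    [Gam]. *)
Lemma PhiJ_Gam v x : v \in Gam -> Phi x ^ v = Phi (v x).
Proof.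
pose W := [set v : {perm X} | [forall x, Phi x ^ v == Phi (v x)]].
have WP w : reflect (forall x, Phi x ^ w = Phi (w x)) (w \in W).
  by rewrite inE; apply: (iffP forallP) => H y; apply/eqP.
have gW : group_set W.
  apply/group_setP; split; first by apply/WP => y; rewrite conjg1 perm1.
  by move=> a b /WP Wa /WP Wb; apply/WP => y; rewrite conjgM Wa Wb permM.
suffices : Gam \subset Group gW by move/subsetP => H /H /WP.
rewrite gen_subG subUset; apply/andP; split.
  by apply/subsetP => _ /imsetP[y _ ->]; apply/WP.
by apply/subsetP => _ /imsetP[y _ ->]; apply/WP.
Qed.

Local Notation rhoG := (rho G_Gam T_inj).

Let A := <<[set Phi x | x : X]>>%G.

Lemma A_normal : A <| Gam.
Proof.
rewrite /normal gen_subG; apply/andP; split.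
  by apply/subsetP => _ /imsetP[x _ ->]; apply: Phi_Gam.
apply: norms_gen; apply/subsetP => v Gv; rewrite inE.
by apply/subsetP => _ /imsetP[_ /imsetP[x _ ->] ->]; rewrite PhiJ_Gam // imset_f.
Qed.

Lemma Phi_A x : Phi x \in A.
Proof. by rewrite mem_gen // imset_f. Qed.

Lemma class_Phi (x : X) : [transitive A, on [set: X] | 'P] ->
  Phi x ^: A = [set Phi y | y : X].
Proof.
move=> trA; apply/setP => w; apply/imsetP/imsetP => [[v Av ->] | [y _ ->]].
  by exists (v x); rewrite ?PhiJ_Gam // (subsetP (normal_sub A_normal)).
have [v Av ->] := atransP2 trA (in_setT x) (in_setT y).
by exists v; rewrite //= apermE PhiJ_Gam // (subsetP (normal_sub A_normal)).
Qed.

(** The stabilizer of [x] in [A] centralizes [Phi x], so the class of [Phi x] has size dividing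
    [p]. *)
Lemma card_Phi (x : X) : [transitive A, on [set: X] | 'P] ->
  #|[set Phi y | y : X]| = 1%N \/ #|[set Phi y | y : X]| = p.
Proof.
move=> trA; rewrite -(class_Phi x trA) -index_cent1.
have : #|A : 'C_A[Phi x]| %| p.
  have <- : #|orbit 'P A x| = p by rewrite (atransP trA) // cardsT.
  rewrite card_orbit indexgS // subsetI subsetIl.
  apply/subsetP => v /setIP[Av /astab1P /= vx]; rewrite apermE in vx.
  apply/cent1P/commute_sym/commgP/conjg_fixP.
  by rewrite PhiJ_Gam ?vx // (subsetP (normal_sub A_normal)).
by case/primeP: p_pr => _ dv /dv/orP[]/eqP; [left | right].
Qed.

Definition affine_form (theta : X -> 'F_p) := exists gam kap h al : 'F_p,
  [/\ gam != 0, al != 0, al != 1,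
      forall x y, theta (G x y) = gam * theta y + kap * theta x + h
    & forall b x, theta (Phi b x) = al * theta x + (1 - al) * theta b]%R.

Definition translation_form (theta : X -> 'F_p) := exists h c : 'F_p,
  [/\ (c, h) != (0, 0),
      forall x y, theta (G x y) = theta y + h
    & forall b x, theta (Phi b x) = theta x + c]%R.

Lemma translation_form_A1 : A :=: 1 ->
  exists2 theta : X -> 'F_p, bijective theta & translation_form theta.
Proof.
move=> A1; have Phi1 x : Phi x = 1 by apply/set1P; move: (Phi_A x); rewrite A1.
have genG : <<[set G x | x : X]>> = Gam.
  apply/eqP; rewrite eqEsubset genS ?subsetUl //= gen_subG subUset sub_gen //=.
  by apply/subsetP => _ /imsetP[x _ ->]; rewrite Phi1 group1.
have rhoC x b : rhoG x ^ rhoG b = rhoG x.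
  by rewrite (rhoJ_rho G_Gam PhiJ_Gam G_Phi) Phi1 perm1.
have [u ou Gu] := commuting_rho_constant p_pr cardX genG trGam rhoC.
have [theta [theta_bij thetaU _]] := order_p_coordinate p_pr cardX ou.
exists theta => //; exists 1%R, 0%R; split=> [|x y|b x].
- by rewrite xpair_eqE eqxx oner_eq0.
- by rewrite Gu thetaU.
by rewrite Phi1 perm1 addr0.
Qed.

(** The common value [c] of [Phi] has order [p]. Conjugating [rho x] by itself gives
    [rho (c x) = rho x], so [G] is constant; its value commutes with [c] and is thus a power of
    [c]. *)
Lemma translation_form_const : [transitive A, on [set: X] | 'P] ->
    #|[set Phi y | y : X]| = 1%N ->
  exists2 theta : X -> 'F_p, bijective theta & translation_form theta.
Proof.
move=> trA /eqP/cards1P[c DPhi].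
have Phic x : Phi x = c by apply/set1P; rewrite -DPhi imset_f.
have DA : A :=: <[c]> by rewrite /= DPhi.
have [u Au ou] := trans_order_p p_pr cardX trA.
have cu : c \in <[u]>.
  rewrite -(cent_order_p p_pr cardX _ ou) -cent_cycle.
  have : u \in <[c]> by move: (Au); rewrite DA.
  by rewrite -cycle_subG => /centS/subsetP; apply; rewrite cent_cycle cent1id.
have Du : <[c]> = <[u]> by apply/eqP; rewrite eqEsubset !cycle_subG cu; move: Au; rewrite DA.
have oc : #[c] = p by rewrite orderE Du -orderE.
have [theta [theta_bij thetaU _]] := order_p_coordinate p_pr cardX oc.
have rho_c x : rhoG (c x) = rhoG x.
  by rewrite -{1}(Phic x) -(rhoJ_rho G_Gam PhiJ_Gam G_Phi) conjgE mulKg.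
have trc : [transitive <[c]>, on [set: X] | 'P] := cycle_trans p_pr cardX oc.
have G_const x y : G x = G y.
  have [_ /cycleP[n ->] ->] := atransP2 trc (in_setT y) (in_setT x).
  rewrite /= apermE -!(rho1 G_Gam T_inj); congr (fun_of_perm _ _).
  elim: n => [|n IHn]; first by rewrite perm1.
  by rewrite expgSr permM rho_c.
exists theta => //; have [x0] := card_prime_inhabited p_pr cardX.
have : G x0 \in <[c]>.
  rewrite -(cent_order_p p_pr cardX _ oc).
  by apply/cent1P/commute_sym/commgP/conjg_fixP; rewrite -(Phic x0) PhiG !Phic.
case/cycleP => k Dk; exists (k%:R)%R, 1%R; split=> [|x y|b x].
- by rewrite xpair_eqE oner_eq0.
- rewrite (G_const x x0) Dk; elim: k {Dk} => [|k IHk]; first by rewrite perm1 addr0.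
  by rewrite expgSr permM thetaU IHk -addrA -natr1.
by rewrite Phic thetaU.
Qed.

Lemma affine_form_inj : [transitive A, on [set: X] | 'P] ->
    #|[set Phi y | y : X]| = p ->
  exists2 theta : X -> 'F_p, bijective theta & affine_form theta.
Proof.
move=> trA cardPhi; have [x0] := card_prime_inhabited p_pr cardX.
have Phi_inj : injective Phi.
  move=> x y; have /imset_injP : #|[set Phi y | y in X]| == #|X| by rewrite cardPhi cardX.
  by apply.
have cl := class_Phi x0 trA.
have nA'A : A^`(1) <| A := der_normal 1 A.
(* Otherwise [A] would be abelian and the class of [Phi x0] a singleton. *)
have trA' : [transitive A^`(1), on [set: X] | 'P].
  have [A'1|//] := normal_prime_trans p_pr cardX nA'A trA.
  have abA : abelian A by rewrite /abelian; apply/commG1P.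
  have := cardPhi; rewrite -cl -index_cent1.
  have /setIidPl -> : A \subset 'C[Phi x0] by rewrite sub_cent1 (subsetP abA) ?Phi_A.
  by rewrite indexgg => p1; move: p_pr; rewrite -p1.
have [u A'u ou] := trans_order_p p_pr cardX trA'.
have Au : u \in A := subsetP (normal_sub nA'A) u A'u.
have Cu : 'C_A[u] = <[u]>.
  apply/setP => v; rewrite inE (cent_order_p p_pr cardX _ ou).
  by rewrite andb_idl //; apply: subsetP; rewrite cycle_subG.
have A'_dv : #|A^`(1)| %| p ^ 2.
  apply: (@prime_class_der1 _ A p (Phi x0) u) => //.
  - exact: Phi_A.
  - by rewrite cl.
  - by rewrite cl.
  - by rewrite Cu -orderE.
  exact: perm_p2_ndvd.
have DA' : A^`(1) = <[u]>.
  apply/eqP; rewrite eq_sym eqEcard cycle_subG A'u -orderE ou /=.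
  have /(dvdn_pfactor _ _ p_pr)[[|[|[|k]]] // _ Dk] := A'_dv; rewrite Dk ?expn0 ?prime_gt0 //.
  by case/negP: (perm_p2_ndvd p_pr cardX A^`(1)); rewrite Dk.
(* The derived subgroup of the normal subgroup [A] is normal in [Gam]. *)
have nuG v : v \in Gam -> v \in 'N(<[u]>).
  rewrite -DA' => Gv; apply: subsetP Gv; apply: normal_norm.
  exact: gFnormal_trans A_normal.
have [theta [theta_bij thetaU affN]] := order_p_coordinate p_pr cardX ou.
have [psi thetaK psiK] := theta_bij.
have N_affine v : v \in Gam -> exists lam del : 'F_p,
    lam != 0%R /\ forall x, theta (v x) = (lam * theta x + del)%R.
  by move/nuG/affN.
exists theta => //.
have [al [del0 [al0 Phi0E]]] := N_affine _ (Phi_Gam x0).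
(* All [Phi b] are conjugate under affine maps, so they share one slope. *)
have Phi_al b : exists del, forall x, theta (Phi b x) = (al * theta x + del)%R.
  have [v Av Dv] := atransP2 trA (in_setT x0) (in_setT b).
  have Gv : v \in Gam := subsetP (normal_sub A_normal) v Av.
  have Db : Phi b = Phi x0 ^ v by rewrite PhiJ_Gam // Dv.
  have [mu [nu [mu0 vE]]] := N_affine v Gv.
  have [lam [del [lam0 PbE]]] := N_affine _ (Phi_Gam b).
  suffices Dlam : lam = al by exists del; rewrite -Dlam.
  have E z : (lam * (mu * theta z + nu) + del = mu * (al * theta z + del0) + nu)%R.
    by rewrite -vE -PbE Db permJ vE Phi0E.
  have E0 := E (psi 0%R); have E1 := E (psi 1%R); rewrite !psiK in E0 E1.
  apply: (mulfI mu0).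
  have -> : (mu * lam = lam * (mu * 1 + nu) + del - (lam * (mu * 0 + nu) + del))%R by ring.
  by rewrite E0 E1; ring.
have Phi_fix b : Phi b b = b.
  by apply: Phi_inj; rewrite -PhiPhi conjgE mulKg.
have PhiE b x : theta (Phi b x) = (al * theta x + (1 - al) * theta b)%R.
  have [del E] := Phi_al b; have := E b; rewrite Phi_fix E => Eb.
  have -> : del = (theta b - al * theta b)%R by rewrite {1}Eb; ring.
  by ring.
have al1 : al != 1%R.
  apply/eqP => al1; have : psi 0%R = psi 1%R.
    apply: Phi_inj; apply/permP => x; apply: (can_inj thetaK).
    by rewrite !PhiE al1; ring.
  by move/(can_inj psiK)/eqP; rewrite eq_sym oner_eq0.
have [gam [kap [h [gam0 GE]]]] :=
  affine_rack_G_affine G_Gam PhiJ_Gam G_Phi T_inj theta_bij al0 al1 N_affine PhiE.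
by exists gam, kap, h, al.
Qed.

Lemma rack_coordinates : exists2 theta : X -> 'F_p, bijective theta &
  affine_form theta \/ translation_form theta.
Proof.
have [x0] := card_prime_inhabited p_pr cardX.
have [A1|trA] := normal_prime_trans p_pr cardX A_normal trGam.
  by have [theta bij tr] := translation_form_A1 A1; exists theta => //; right.
have [c1|cp] := card_Phi x0 trA.
  by have [theta bij tr] := translation_form_const trA c1; exists theta => //; right.
by have [theta bij af] := affine_form_inj trA cp; exists theta => //; left.
Qed.
End Coordinates.

Local Open Scope ring_scope.

(** * Braided sets *)

Section BraidEquations.
Variables (X : Type) (S : X * X -> X * X).
Let g := braid_g S.
Let f := braid_f S.

Lemma braid_gf x y : S (x, y) = (g x y, f y x).
Proof. exact: surjective_pairing. Qed.

Hypothesis braid : braid1 S \o braid2 S \o braid1 S =1 braid2 S \o braid1 S \o braid2 S.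

Lemma braid_equations x y z :
  [/\ g x (g y z) = g (g x y) (g (f y x) z),
      f (g (f y x) z) (g x y) = g (f (g y z) x) (f z y)
    & f z (f y x) = f (f z y) (f (g y z) x)].
Proof.
have b1 a b c : braid1 S (a, b, c) = (g a b, f b a, c) by rewrite /braid1 braid_gf.
have b2 a b c : braid2 S (a, b, c) = (a, g b c, f c b) by rewrite /braid2 braid_gf.
by have := braid (x, y, z); rewrite /comp !(b1, b2) => -[-> -> ->].
Qed.
End BraidEquations.

Lemma isomorphic_solution (X X' : Type) (S : X * X -> X * X) (S' : X' * X' -> X' * X') :
  solution S -> isomorphic S S' -> solution S'.
Proof.
move=> [[[x0] bijS braidS] [bij_g bij_f]] [theta bij_theta iso].
have [psi thetaK psiK] := bij_theta; have bij_psi : bijective psi by exists theta.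
pose th2 (u : X * X) := (theta u.1, theta u.2).
have S'E x y : S' (theta x, theta y) = th2 (S (x, y)) by have := iso (x, y); rewrite /= => <-.
pose ps2 (u : X' * X') := (psi u.1, psi u.2).
have bij2 : bijective th2 by exists ps2 => -[x y]; rewrite /th2 /ps2 /= ?thetaK ?psiK.
have bij2' : bijective ps2 by exists th2 => -[x y]; rewrite /th2 /ps2 /= ?thetaK ?psiK.
have S'K : th2 \o S \o ps2 =1 S'.
  by move=> [x y]; rewrite /= /ps2 -S'E /= !psiK.
split; first split; first by exists; exact (theta x0).
- by apply: eq_bij S'K; apply: bij_comp bij2'; apply: bij_comp bijS.
- pose th3 (u : X * X * X) := (theta u.1.1, theta u.1.2, theta u.2).
  have b1 u : braid1 S' (th3 u) = th3 (braid1 S u).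
    by case: u => [[x y] z]; rewrite /= S'E; case: (S (x, y)).
  have b2 u : braid2 S' (th3 u) = th3 (braid2 S u).
    by case: u => [[x y] z]; rewrite /= S'E; case: (S (y, z)).
  move=> [[x y] z]; have -> : (x, y, z) = th3 (psi x, psi y, psi z).
    by rewrite /th3 /= !psiK.
  by rewrite /comp !(b1, b2); congr th3; apply: braidS.
split=> x.
  apply: (@eq_bij _ _ (theta \o braid_g S (psi x) \o psi)).
    by apply: bij_comp bij_psi; apply: bij_comp bij_theta (bij_g _).
  by move=> y; rewrite /braid_g -S'K.
apply: (@eq_bij _ _ (theta \o braid_f S (psi x) \o psi)).
  by apply: bij_comp bij_psi; apply: bij_comp bij_theta (bij_f _).
by move=> y; rewrite /braid_f -S'K.
Qed.

(** * The derived rack of a solution *)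

Section Rack.
Variables (X : finType) (S : X * X -> X * X).
Hypothesis solS : solution S.
Local Open Scope group_scope.

(* Soloviev's derived rack: Phi b x = g_b (f_y x) where b = g_x y. *)
Lemma solution_rack : exists G Phi : X -> {perm X},
  [/\ forall x y, S (x, y) = (G x y, (G (G x y))^-1 (Phi (G x y) x)),
      forall x y, Phi y ^ G x = Phi (G x y),
      forall x y, Phi y ^ Phi x = Phi (Phi x y),
      forall x b, G ((G x)^-1 b) * G x = G ((G b)^-1 (Phi b x)) * G b
    & injective (fun x => (G x)^-1 x)].
Proof.
have [[_ bijS braidS] [bij_g bij_f]] := solS.
pose g := braid_g S; pose f := braid_f S.
have E x y z := braid_equations braidS x y z.
have E1 x y z : g x (g y z) = g (g x y) (g (f y x) z) by case: (E x y z).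
have E2 x y z : f (g (f y x) z) (g x y) = g (f (g y z) x) (f z y) by case: (E x y z).
have E3 x y z : f z (f y x) = f (f z y) (f (g y z) x) by case: (E x y z).
pose G x := perm (bij_inj (bij_g x)).
have GE x y : G x y = g x y by rewrite permE.
pose phi b x := g b (f ((G x)^-1 b) x).
have GK x y : (G x)^-1 (g x y) = y by rewrite -GE permK.
have phiE x y : phi (g x y) x = g (g x y) (f y x) by rewrite /phi GK.
have gV x b : exists y, b = g x y by exists ((G x)^-1 b); rewrite -GE permKV.
(* If [phi b] identified [x] and [x'], then [S] would identify two pairs starting with [x] and
   [x']. *)
have phi_inj b : injective (phi b).
  move=> x x'; have [[y Dy] [y' Dy']] := (gV x b, gV x' b).
  rewrite {1}Dy {1}Dy' !phiE -Dy -Dy' => /(bij_inj (bij_g b)) eqf.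
  suffices : (x, y) = (x', y') by case.
  by apply: (bij_inj bijS); rewrite !braid_gf -/g -/f -Dy -Dy' eqf.
have H1 x c y : phi (g x c) (g x y) = g x (phi c y).
  have [z ->] := gV y c.
  by rewrite phiE [RHS]E1 -E2 E1 phiE.
have H2 a b x : phi (phi a b) (phi a x) = phi a (phi b x).
  (* Taking [b = g x y] and [a = g x (g y z)] brings in the braid equations for the triple [x], [y],
     [z]. *)
  have [y ->] := gV x b; have [z' ->] := gV (g x y) a; have [z ->] := gV (f y x) z'.
  have pb : phi (g (g x y) (g (f y x) z)) (phi (g x y) x) =
      g (g x y) (g (g (f y x) z) (f z (f y x))) by rewrite (phiE x y) H1 phiE.
  rewrite pb -(E1 x y z).
  have -> : phi (g x (g y z)) (g x y) = g x (g (g y z) (f z y)) by rewrite H1 phiE.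
  rewrite (phiE x (g y z)) (E1 x (g y z) (f z y)) H1 phiE -E3.
  by rewrite [RHS]E1 E2 -(E1 x y z).
pose Phi b := perm (@phi_inj b).
have PhiE b x : Phi b x = phi b x by rewrite permE.
exists G, Phi; split.
- move=> x y; rewrite braid_gf -/g -/f; congr (_, _); first by rewrite GE.
  by apply: (@perm_inj _ (G (G x y))); rewrite permKV PhiE !GE phiE.
- move=> x y; apply/permP => z; rewrite -[z](permKV (G x)) permJ.
  by rewrite !PhiE !GE H1.
- move=> x y; apply/permP => z; rewrite -[z](permKV (Phi x)) permJ.
  by rewrite !PhiE H2.
- move=> x b; have [y ->] := gV x b.
  rewrite PhiE phiE !GK.
  by apply/permP => z; rewrite !permM !GE.
move=> x x' /= eqT; set t := (G x)^-1 x in eqT.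
have gxt : g x t = x by rewrite -GE permKV.
have gxt' : g x' t = x' by rewrite -GE eqT permKV.
(* When [g z t = z], the value [f t z] depends on [t] alone; as [f t] is injective, [z] is
   unique. *)
have ft z : g z t = z -> f t z = phi t t.
  move=> gzt; apply: (bij_inj (bij_g z)).
  by have := phiE z t; rewrite gzt -/g -H1 gzt => <-.
by apply: (bij_inj (bij_f t)); rewrite [LHS]ft // [RHS]ft.
Qed.
End Rack.

Section Transitive.
Variables (X : finType) (S : X * X -> X * X) (G Phi : X -> {perm X}).
Local Open Scope group_scope.
Hypothesis SE : forall x y, S (x, y) = (G x y, (G (G x y))^-1 (Phi (G x y) x)).

(** Both components of [S (x, y)] are images of [y] and [x] under the group, so an orbit and its
    complement are stable. *)
Lemma indecomposable_trans : inhabited X -> indecomposable S ->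
  [transitive <<[set G x | x : X] :|: [set Phi x | x : X]>>, on [set: X] | 'P].
Proof.
move=> [x0] indec; set Gam := <<_>>.
have [Y0 | nY] := eqVneq (orbit 'P Gam x0) setT; first by apply/imsetP; exists x0.
case: indec; pose Y x := x \in orbit 'P Gam x0.
have Gam_orb v x : v \in Gam -> (v x \in orbit 'P Gam x0) = (x \in orbit 'P Gam x0).
  by move=> Gv; rewrite -[v x]apermE; apply: (orbit_actr 'P).
have GG x : G x \in Gam by rewrite mem_gen // inE imset_f.
have GPhi x : Phi x \in Gam by rewrite mem_gen // inE orbC imset_f.
exists Y, (fun x => ~ Y x); split.
- by move=> x; rewrite /Y; case: (x \in _); [left | right].
- by move=> x [].
- by exists x0; apply: orbit_refl.
- have [|x] := subsetPn (_ : ~~ (setT \subset orbit 'P Gam x0)); last by exists x; apply/negP.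
  by rewrite subTset.
by split=> x y; rewrite /Y SE /= !Gam_orb ?groupV.
Qed.
End Transitive.

(** * Normal forms over the prime field *)

Lemma affine_solution_of_isomorphic (A : pzRingType) (X : Type) (S : X * X -> X * X)
    (S0 : A * A -> A * A) (a b c d h t : A) :
  solution S -> isomorphic S S0 ->
  (forall x y, S0 (x, y) = (a * x + b * y + h, c * x + d * y + t)) ->
  affine_solution S0.
Proof.
move=> solS iso S0E; split; first exact: isomorphic_solution iso.
by exists (a \*o idfun), (b \*o idfun), (c \*o idfun), (d \*o idfun), h, t.
Qed.

Theorem theorem3p1 (p : nat) (p_prime : prime p) (X : finType)
    (S : X * X -> X * X) (S_solution : solution S)
    (S_indec : indecomposable S) (cardX : #|X| = p) :
  (exists2 S0 : 'F_p * 'F_p -> 'F_p * 'F_p,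
     affine_solution S0 & isomorphic S S0)
  /\
  [\/ exists q1 q2 h : 'F_p,
        [/\ q1 != 0, q2 != 0, q1 != q2
          & isomorphic S (fun u : 'F_p * 'F_p => let: (x, y) := u in
              (q1^-1 * y + (1 - q2 * q1^-1) * x + h, q2 * x - q1 * h))],
      exists q1 q2 h : 'F_p,
        [/\ q1 != 0, q2 != 0, q1 != q2
          & isomorphic S (fun u : 'F_p * 'F_p => let: (x, y) := u in
              (q1^-1 * y + h, q2 * x + (1 - q2 * q1^-1) * y - q2 * h))]
    | exists h1 h2 : 'F_p,
        (h1, h2) != (0, 0) /\
        isomorphic S (fun u : 'F_p * 'F_p => let: (x, y) := u in
          (y + h1, x + h2))].
Proof.
have [G [Phi [SE PhiG PhiPhi G_Phi T_inj]]] := solution_rack S_solution.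
have trGam := indecomposable_trans SE (card_prime_inhabited p_prime cardX) S_indec.
have [theta theta_bij form] := rack_coordinates p_prime cardX PhiG PhiPhi G_Phi T_inj trGam.
have [psi thetaK psiK] := theta_bij.
case: form => [[gam [kap [h [al [gam0 al0 al1 GE PhiE]]]]] | [h [c [hc GE PhiE]]]]; last first.
  (* Undoing the shift [h] of [G] after the shift [c] of [Phi] leaves [c - h]. *)
  pose S0 (u : 'F_p * 'F_p) := let: (x, y) := u in (y + h, x + (c - h)).
  have iso : isomorphic S S0.
    exists theta => //= -[x y]; rewrite /= SE /= GE; congr (_, _).
    set b := G x y; have := GE b ((G b)^-1 (Phi b x))%g.
    by rewrite permKV PhiE => E; rewrite -[LHS](addrK h) -E addrA.
  split; last first.
    apply: Or33; exists h, (c - h); split=> //; apply: contra hc.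
    by rewrite !xpair_eqE subr_eq0 => /andP[/eqP-> ->]; rewrite eqxx.
  exists S0 => //; apply: (@affine_solution_of_isomorphic _ _ S _ 0 1 1 0 h (c - h)) => // x y.
  by rewrite /S0 !mul0r !mul1r add0r addr0.
have fE b z : theta ((G b)^-1 z)%g = gam^-1 * (theta z - kap * theta b - h).
  have := GE b ((G b)^-1 z)%g; rewrite permKV => ->.
  by field.
have kap_eq : kap = 0 \/ kap = 1 - al.
  have [->|kap0] := eqVneq kap 0; [by left | right].
  (* This is [G_Phi] evaluated at the origin, for [x] of coordinate 0 and [y] of coordinate [z].
     Comparing slopes in [z] gives [kap * gam * (1 - al - kap) = 0]. *)
  have E z : gam * kap * z =
      kap * ((1 - al - kap) * (gam * z + h) - h) + kap * (gam * z + h).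
    pose x := psi 0; pose y := psi z; pose b := G x y.
    have := congr1 (fun v : {perm X} => theta (v (psi 0))) (G_Phi x b).
    rewrite !permM (_ : (G x)^-1 b = y)%g; last by rewrite permK.
    rewrite !GE fE PhiE GE !psiK => raw.
    have -> : gam * kap * z = (gam * (gam * 0 + kap * z + h) + kap * 0 + h) - (gam * h + h) by ring.
    by rewrite raw; field.
  have : kap * gam * (1 - al - kap) = 0.
    pose r z := kap * ((1 - al - kap) * (gam * z + h) - h) + kap * (gam * z + h).
    have -> : kap * gam * (1 - al - kap) = r 1 - r 0 - gam * kap * 1 by rewrite /r; ring.
    by rewrite /r -!E; ring.
  move/eqP; rewrite !mulf_eq0 (negPf kap0) (negPf gam0) /= subr_eq0 => /eqP.
  by [].
(* Thus [gam = q1^-1] and [al = q2 * q1^-1], and [al != 1] becomes [q1 != q2]. Form (ii) is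
   [kap = 0], form (i) is [kap = 1 - al]. *)
pose q1 := gam^-1; pose q2 := al / gam.
have q10 : q1 != 0 by rewrite invr_eq0.
have q20 : q2 != 0 by rewrite mulf_neq0 ?invr_eq0.
have q12 : q1 != q2.
  apply: contra al1 => /eqP q12; rewrite -(inj_eq (mulIf q10)) mul1r.
  by rewrite -/q2 q12.
have SthetaE x y : (theta (S (x, y)).1 = gam * theta y + kap * theta x + h) /\
    (theta (S (x, y)).2 = gam^-1 *
      (al * theta x + (1 - al - kap) * (gam * theta y + kap * theta x + h) - h)).
  by rewrite SE /= fE PhiE !GE; split=> //; field.
case: kap_eq => Dkap; rewrite Dkap in SthetaE.
  pose S0 (u : 'F_p * 'F_p) := let: (x, y) := u in
    (q1^-1 * y + h, q2 * x + (1 - q2 * q1^-1) * y - q2 * h).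
  have iso : isomorphic S S0.
    exists theta => //= -[x y]; rewrite /=; have [-> ->] := SthetaE x y.
    by rewrite /q1 /q2; congr (_, _); field; rewrite ?gam0 ?oner_eq0.
  split; last by apply: Or32; exists q1, q2, h.
  exists S0 => //; apply: (@affine_solution_of_isomorphic _ _ S _
    0 q1^-1 q2 (1 - q2 * q1^-1) h (- (q2 * h))) => // x y.
  by rewrite /S0 mul0r add0r.
pose S0 (u : 'F_p * 'F_p) := let: (x, y) := u in
  (q1^-1 * y + (1 - q2 * q1^-1) * x + h, q2 * x - q1 * h).
have iso : isomorphic S S0.
  exists theta => //= -[x y]; rewrite /=; have [-> ->] := SthetaE x y.
  by rewrite /q1 /q2; congr (_, _); field; rewrite ?gam0 ?oner_eq0.
split; last by apply: Or31; exists q1, q2, h.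
exists S0 => //; apply: (@affine_solution_of_isomorphic _ _ S _
  (1 - q2 * q1^-1) q1^-1 q2 0 h (- (q1 * h))) => // x y.
by rewrite /S0 mul0r addr0 [X in (X + h, _)]addrC.
Qed.
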